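(* Let $\mathbb{K}\in\{\mathbb{R},\mathbb{C}\}$ and let $f\in\mathbb{K}[x_1,\dots,x_n]$ be homogeneous of degree $3$ such that the subspace $\mathcal{V}$ spanned by its $n$ slices is non-singular, satisfies the Commutativity Property but does not satisfy the Diagonalisability Property. Let $h(x)=f(Rx)$ where the entries of $R$ are chosen uniformly and independently at random from a finite set $S\subset\mathbb{K}$, and let $T_1,\dots,T_n$ be the slices of $h$; if $T_1$ is invertible let $T_1'=T_1^{-1}$. Then $\Pr_R[T_1\text{ is invertible and }T_1'T_2\text{ is diagonalisable}]\le\frac{1}{|S|}$.
   Context: Slices of a cubic form $g=\sum T_{ijk}x_ix_jx_k$ with $(T_{ijk})$ symmetric: $T_k=(T_{ijk})_{1\le i,j\le n}$. A subspace of matrices is non-singular if it contains an invertible matrix. A non-singular subspace $\mathcal{V}$ satisfies the Commutativity Property if there is an invertible $A\in\mathcal{V}$ with $A^{-1}\mathcal{V}$ commuting, and the Diagonalisability Property if there is an invertible $B\in\mathcal{V}$ such that every matrix of $B^{-1}\mathcal{V}$ is diagonalisable over $\mathbb{K}$. Diagonalisable means over $\mathbb{K}$. *)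

(* Defs.v *)
From HB Require Import structures.
From mathcomp Require Import all_boot all_order all_algebra.
From mathcomp Require Import boolp reals finmap complex mpoly.

Set Implicit Arguments.
Unset Strict Implicit.
Unset Printing Implicit Defensive.

Import Order.TTheory GRing.Theory Num.Theory.
Local Open Scope ring_scope.

Variant scalar_kind := RealScalars | ComplexScalars.

Definition scalars (R : realType) (k : scalar_kind) : numFieldType :=
  match k with
  | RealScalars => R : numFieldType
  | ComplexScalars => R[i]%C : numFieldType
  end.

Section Tensor.
Variables (K : numFieldType) (n : nat).
Implicit Types (f : {mpoly K[n]}) (T : 'I_n -> 'I_n -> 'I_n -> K).

Definition symmetric_tensor T :=
  forall i j k, T i j k = T j i k /\ T i j k = T i k j.

Definition cubic_form T : {mpoly K[n]} :=
  \sum_(i < n) \sum_(j < n) \sum_(k < n) T i j k *: ('X_i * 'X_j * 'X_k).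

Definition mnm3 (i j k : 'I_n) : 'X_{1..n} := (U_(i) + U_(j) + U_(k))%MM.

(* The unique symmetric tensor T with f = cubic_form T, when f is homogeneous
   of degree 3 (cubic_tensor_sym, cubic_tensorK and cubic_formK below): the
   coefficient of x_i x_j x_k in f is shared equally between the entries of T
   that contribute to this monomial. *)
Definition cubic_tensor f (i j k : 'I_n) : K :=
  f@_(mnm3 i j k) /
  #|[set t : 'I_n * 'I_n * 'I_n | mnm3 t.1.1 t.1.2 t.2 == mnm3 i j k]|%:R.

Definition slice f (k : 'I_n) : 'M[K]_n := \matrix_(i, j) cubic_tensor f i j k.

Definition slice_space f : {vspace 'M[K]_n} := <<[seq slice f k | k <- enum 'I_n]>>%VS.

(* f(Ax) *)
Definition linear_subst f (A : 'M[K]_n) : {mpoly K[n]} :=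
  f \mPo [tuple \sum_(j < n) A i j *: 'X_j | i < n].

Lemma cubic_tensor_sym f : symmetric_tensor (cubic_tensor f).
Proof.
have e1 i j k : mnm3 i j k = mnm3 j i k by rewrite /mnm3 (addmC U_(i)%MM).
have e2 i j k : mnm3 i j k = mnm3 i k j by rewrite /mnm3 -!addmA (addmC U_(j)%MM).
by move=> i j k; rewrite /cubic_tensor (e1 i j k); split=> //; rewrite -e1 e2.
Qed.

Lemma cubic_formE T : cubic_form T =
  \sum_(t : 'I_n * 'I_n * 'I_n) T t.1.1 t.1.2 t.2 *: 'X_[mnm3 t.1.1 t.1.2 t.2].
Proof.
rewrite /cubic_form pair_bigA /= pair_bigA /=.
by apply: eq_bigr => -[[i j] k] _ /=; rewrite /mnm3 !mpolyXD.
Qed.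

Lemma mcoeff_cubic_form T m : (cubic_form T)@_m =
  \sum_(t : 'I_n * 'I_n * 'I_n | mnm3 t.1.1 t.1.2 t.2 == m) T t.1.1 t.1.2 t.2.
Proof.
rewrite cubic_formE raddf_sum [RHS]big_mkcond /=; apply: eq_bigr => t _.
by rewrite mcoeffZ mcoeffX; case: eqP; rewrite ?mulr1 ?mulr0.
Qed.

Lemma symmetric_mnm3 T a b c i j k : symmetric_tensor T ->
  mnm3 a b c = mnm3 i j k -> T a b c = T i j k.
Proof.
move=> sT.
have s1 x y z : T x y z = T y x z by case: (sT x y z).
have s2 x y z : T x y z = T x z y by case: (sT x y z).
have inj (x y : 'I_n) : U_(x)%MM = U_(y)%MM -> x = y.
  move/(congr1 (fun m : 'X_{1..n} => m x)); rewrite !mnm1E eqxx.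
  by case: eqP => [->|].
have addI (m p q : 'X_{1..n}) : (m + p = m + q)%MM -> p = q.
  by move=> e; rewrite -(addmK m p) -(addmK m q) ![(_ + m)%MM]addmC e.
have two x y z w : (U_(x) + U_(y) = U_(z) + U_(w) :> 'X_{1..n})%MM ->
    (x = z /\ y = w) \/ (x = w /\ y = z).
  move=> e; have := congr1 (fun m : 'X_{1..n} => m x) e.
  rewrite !mnmDE !mnm1E eqxx.
  case: (eqVneq z x) => [ez|_]; first by left; subst z; split=> //; apply/inj/addI/e.
  case: (eqVneq w x) => [ew|_] //=; right; subst w; split=> //.
  by move: e; rewrite (addmC U_(z)%MM) => /addI /inj.
have fst x y z v w : mnm3 x y z = mnm3 x v w -> T x y z = T x v w.
  rewrite /mnm3 -!addmA => /addI /two [] [-> ->] //.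
move=> e; have := congr1 (fun m : 'X_{1..n} => m a) e.
rewrite /mnm3 !mnmDE !mnm1E eqxx.
case: (eqVneq i a) => [ei|_]; first by subst i => _; apply: fst.
case: (eqVneq j a) => [ej|_].
  subst j => _; rewrite (s1 i); apply: fst.
  by rewrite e /mnm3 (addmC U_(a)%MM).
case: (eqVneq k a) => [ek|_] //= _; subst k.
rewrite (s2 i) (s1 i); apply: fst.
by rewrite e /mnm3 addmC addmA.
Qed.

Lemma cubic_tensorK f : f \is 3.-homog -> cubic_form (cubic_tensor f) = f.
Proof.
move=> fh; apply/mpolyP => m; rewrite mcoeff_cubic_form.
case: (pickP (fun t : 'I_n * 'I_n * 'I_n => mnm3 t.1.1 t.1.2 t.2 == m)) => [t0 /eqP m0|no].
  under eq_bigr => t /eqP mt do rewrite /cubic_tensor mt.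
  rewrite sumr_const cardsE -[X in X *+ _]mulr1 -mulrA -mulrnAr.
  rewrite mulr1 -[X in _ * X]mulr_natr mulVf ?mulr1 //.
  by rewrite pnatr_eq0 -lt0n; apply/card_gt0P; exists t0; exact: (introT eqP m0).
rewrite big_pred0 //; apply/esym/eqP; apply: contraT => fm.
have dm : mdeg m = 3%N by apply: (dhomog_mf fh); rewrite mcoeff_msupp.
have step d (p : 'X_{1..n}) : mdeg p = d.+1 ->
    exists i (q : 'X_{1..n}), p = (q + U_(i))%MM /\ mdeg q = d.
  move=> dp; have [i pi|p0] := pickP (fun i => p i != 0%N).
    have le : (U_(i) <= p)%MM by rewrite lep1mP.
    exists i, (p - U_(i))%MM; rewrite submK //; split=> //.
    by move: dp; rewrite -{1}(submK le) mdegD mdeg1 addn1 => -[].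
  by move: dp; rewrite mdegE big1 // => i _; apply/eqP/negbFE/p0.
have [k [q [em /step [j [q' [eq /step [i [q'' [eq' dq]]]]]]]]] := step _ _ dm.
have/eqP := dq; rewrite mdeg_eq0 => /eqP q0.
by have := no (i, j, k); rewrite /= em eq eq' q0 add0m eqxx.
Qed.

Lemma cubic_formK T : symmetric_tensor T ->
  forall i j k, cubic_tensor (cubic_form T) i j k = T i j k.
Proof.
move=> sT i j k; rewrite /cubic_tensor mcoeff_cubic_form.
under eq_bigr => t /eqP mt do rewrite (symmetric_mnm3 sT mt).
rewrite sumr_const cardsE -[X in X / _]mulr_natr mulfK //.
by rewrite pnatr_eq0 -lt0n; apply/card_gt0P; exists (i, j, k); exact: eqxx.
Qed.

End Tensor.

Section MatrixSpaces.
Variables (K : fieldType) (n : nat).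
Implicit Type V : {vspace 'M[K]_n}.

Definition nonsingular_space V := exists2 A, A \in V & A \in unitmx.

Definition commutativity_property V :=
  exists A : 'M[K]_n, [/\ A \in V, A \in unitmx &
    forall M N, M \in V -> N \in V ->
      comm_mx (invmx A *m M) (invmx A *m N)].

Definition diagonalisability_property V :=
  exists B : 'M[K]_n, [/\ B \in V, B \in unitmx &
    forall M, M \in V -> diagonalizable (invmx B *m M)].

End MatrixSpaces.

(* Probability that E holds for an n x n matrix whose entries are independent
   and uniform in S: each matrix with entries in S has as its mass the product,
   over all entries, of the uniform mass 1 / |S|. *)
Definition prob_entries (R : realType) (K : choiceType) (n : nat)
    (S : {fset K}) (E : 'M[K]_n -> Prop) : R :=
  \sum_(A : 'M[S]_n | `[< E (map_mx val A) >])
    \prod_(i < n) \prod_(j < n) (#|` S|%:R)^-1.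

(* Main.v *)
Require Import Defs.
From HB Require Import structures.
From mathcomp Require Import all_boot all_order all_algebra.
From mathcomp Require Import boolp reals finmap complex mpoly.

Set Implicit Arguments.
Unset Strict Implicit.
Unset Printing Implicit Defensive.

Import Order.TTheory GRing.Theory Num.Theory.
Local Open Scope ring_scope.

(** Write D(v) = sum_k v_k S_k for the slices S_k of f.  The k-th slice of
f(Ax) is A^T D(a_k) A, where a_k is the k-th column of A, so that T_1^-1 T_2 is
similar to D(a_1)^-1 D(a_2).  When B = D(a_1) is invertible, B^-1 V commutes
because A^-1 V does for some A in V; commuting diagonalisable matrices being
closed under linear combinations, the failure of the Diagonalisability Property
yields a slice S_i with B^-1 S_i not diagonalisable.  Once all entries of a_2
but the i-th are fixed, at most one value of the i-th entry makes
B^-1 D(a_2) diagonalisable, since the difference of two such values would make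
a nonzero multiple of B^-1 S_i diagonalisable.  As i depends only on a_1, this
bounds the probability by 1/|S|. *)

(** * Simultaneous diagonalisation and change of the base matrix *)

Section Diagonalizable.
Variables (F : fieldType) (n : nat).
Implicit Types (A B M N P : 'M[F]_n) (V : {vspace 'M[F]_n}).

(** One [P] diagonalises all of [As] simultaneously, and each off-diagonal entry of
    [P *m M *m invmx P] is linear in [M], so it vanishes on the whole span. *)
Lemma diagonalizable_span (As : seq 'M[F]_n) :
  {in As &, forall M N, comm_mx M N} ->
  (forall M, M \in As -> diagonalizable M) ->
  forall M, M \in <<As>>%VS -> diagonalizable M.
Proof.
move=> cAs dAs M MAs.
have [P Pu /allP diagP] := (codiagonalizableP As).1 (conj cAs dAs).
exists P => //; apply/(similar_diagP _ Pu) => i j neq_ij.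
rewrite (coord_span (X := in_tuple As) MAs) mulmx_sumr mulmx_suml summxE.
apply: big1 => k _; rewrite -scalemxAr -scalemxAl mxE.
have /diagP/(similar_diagP _ Pu)-> : (in_tuple As)`_k \in As by rewrite mem_nth.
  by rewrite mulr0.
by [].
Qed.

Lemma diagonalizable_mulmx_span B (Ms : seq 'M[F]_n) :
  {in Ms &, forall M N, comm_mx (B *m M) (B *m N)} ->
  (forall M, M \in Ms -> diagonalizable (B *m M)) ->
  forall M, M \in <<Ms>>%VS -> diagonalizable (B *m M).
Proof.
move=> cMs dMs M MMs.
apply: (@diagonalizable_span [seq B *m N | N <- Ms])
  => [_ _ /mapP[N1 + ->] /mapP[N2 + ->]|_ /mapP[N + ->]|].
- exact: cMs.
- exact: dMs.
have := memv_img (linfun (mulmx B)) MMs; rewrite limg_span lfunE /=.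
by under eq_map => N do rewrite lfunE.
Qed.

Lemma diagonalizable_conj A M : A \in unitmx ->
  diagonalizable (invmx A *m M *m A) -> diagonalizable M.
Proof.
move=> Au [P Pu /(similar_diagP _ Pu) dP].
have PAu : P *m invmx A \in unitmx by rewrite unitmx_mul Pu unitmx_inv.
exists (P *m invmx A) => //; apply/(similar_diagP _ PAu) => i j /dP.
suff -> : invmx (P *m invmx A) = A *m invmx P by rewrite !mulmxA.
apply: (can_inj (mulKmx PAu)).
by rewrite mulmxV // mulmxA mulmxKV // mulmxV.
Qed.

Lemma comm_mx_inv A M : A \in unitmx -> comm_mx A M -> comm_mx (invmx A) M.
Proof.
move=> Au cAM; apply: (can_inj (mulKmx Au)).
by rewrite mulKVmx // mulmxA cAM mulmxK.
Qed.

(** The matrix [b := invmx A *m B] lies in the commuting space [A^-1 V], so [invmx b] commutes with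
    that space as well, and [B^-1 L = b^-1 (A^-1 L)]. *)
Lemma commutativity_property_all V B : commutativity_property V ->
  B \in V -> B \in unitmx -> forall M N, M \in V -> N \in V ->
  comm_mx (invmx B *m M) (invmx B *m N).
Proof.
move=> [A [AV Au cA]] BV Bu M N MV NV.
pose b := invmx A *m B.
have bu : b \in unitmx by rewrite unitmx_mul unitmx_inv Au.
have invBE L : invmx B *m L = invmx b *m (invmx A *m L).
  by apply: (can_inj (mulKmx bu)); rewrite mulKVmx // -mulmxA mulKVmx.
have cb L (LV : L \in V) := comm_mx_inv bu (cA _ _ BV LV).
rewrite !invBE /comm_mx; move: (cb _ MV) (cb _ NV) (cA _ _ MV NV).
move: (invmx A *m M) (invmx A *m N) => x y cbx cby cxy.
by rewrite -!mulmxA cby cbx (mulmxA x) (mulmxA y) cxy.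
Qed.

End Diagonalizable.

(** * Combinations of slices and their behaviour under substitution *)

Section SliceCombination.
Variables (K : numFieldType) (n : nat).
Implicit Types (f : {mpoly K[n]}) (v w : 'I_n -> K).

Definition slice_comb f v : 'M[K]_n := \sum_k v k *: slice f k.

Lemma mem_slice f k : slice f k \in slice_space f.
Proof. by apply/memv_span/map_f; rewrite mem_enum. Qed.

Lemma mem_slice_comb f v : slice_comb f v \in slice_space f.
Proof. by apply: memv_suml => k _; apply/memvZ/mem_slice. Qed.

Lemma linear_subst_cubic_form T (A : 'M[K]_n) :
  linear_subst (cubic_form T) A = cubic_form (fun a b c =>
    \sum_i \sum_j \sum_k A i a * A j b * A k c * T i j k).
Proof.
rewrite /linear_subst /cubic_form.
pose Y i : {mpoly K[n]} := \sum_j A i j *: 'X_j.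
transitivity (\sum_i \sum_j \sum_k T i j k *: (Y i * Y j * Y k)).
  rewrite raddf_sum; apply: eq_bigr => i _.
  rewrite raddf_sum; apply: eq_bigr => j _.
  rewrite raddf_sum; apply: eq_bigr => k _ /=.
  by rewrite comp_mpolyZ !rmorphM /= !comp_mpolyXU -!tnth_nth !tnth_mktuple.
have YE i j k : T i j k *: (Y i * Y j * Y k) =
    \sum_a \sum_b \sum_c (A i a * A j b * A k c * T i j k) *: ('X_a * 'X_b * 'X_c).
  rewrite /Y !mulr_suml scaler_sumr; apply: eq_bigr => a _.
  rewrite [X in X * _]mulr_sumr mulr_suml scaler_sumr; apply: eq_bigr => b _.
  rewrite mulr_sumr scaler_sumr; apply: eq_bigr => c _.
  rewrite -!scalerAr -!scalerAl !scalerA; congr (_ *: _).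
  by rewrite mulrC (mulrC (T i j k)) mulrA (mulrC (A j b)).
rewrite (eq_bigr _ (fun i _ => eq_bigr _ (fun j _ => eq_bigr _ (fun k _ => YE i j k)))).
(* The sums over [i], [j], [k] are packed into one, so that each exchange below moves one of [a],
   [b], [c] past all three. *)
rewrite (pair_bigA _ (fun i j => \sum_k _)) /= (pair_bigA _ (fun p k => \sum_a _)) /=.
rewrite exchange_big /=; apply: eq_bigr => a _.
rewrite exchange_big /=; apply: eq_bigr => b _.
rewrite exchange_big /=; apply: eq_bigr => c _.
by rewrite -scaler_suml; congr (_ *: _); rewrite !pair_bigA.
Qed.

Lemma slice_linear_subst f (A : 'M[K]_n) c : f \is 3.-homog ->
  slice (linear_subst f A) c = A^T *m slice_comb f (fun k => A k c) *m A.
Proof.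
move=> f_cubic; rewrite -{1}(cubic_tensorK f_cubic) linear_subst_cubic_form.
have s1 i j k : cubic_tensor f i j k = cubic_tensor f j i k.
  by case: (cubic_tensor_sym f i j k).
have s2 i j k : cubic_tensor f i j k = cubic_tensor f i k j.
  by case: (cubic_tensor_sym f i j k).
apply/matrixP => a b; rewrite mxE cubic_formK; last first.
  (* Swapping two indices of the transformed tensor amounts to renaming two summation indices, as
     the tensor of [f] is symmetric. *)
  move=> {a b c} a b c; split.
    rewrite exchange_big /=; do 3 apply: eq_bigr => ? _.
    by rewrite s1 (mulrC (A _ a)).
  apply: eq_bigr => i _; rewrite exchange_big /=; do 2 apply: eq_bigr => ? _.
  by rewrite s2 -!mulrA (mulrCA (A _ b)).
rewrite mxE; under [RHS]eq_bigr do rewrite mxE big_distrl /=.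
rewrite [RHS]exchange_big /=; apply: eq_bigr => i _; apply: eq_bigr => j _.
rewrite summxE big_distrr big_distrl /=; apply: eq_bigr => k _.
by rewrite !mxE [RHS]mulrAC !mulrA.
Qed.

Lemma diagonalizable_linear_subst f (A : 'M[K]_n) i j : f \is 3.-homog ->
  let h := linear_subst f A in
  slice h i \in unitmx -> diagonalizable (invmx (slice h i) *m slice h j) ->
  slice_comb f (A^~ i) \in unitmx /\
  diagonalizable (invmx (slice_comb f (A^~ i)) *m slice_comb f (A^~ j)).
Proof.
move=> f_cubic; rewrite /= !slice_linear_subst //.
set B := slice_comb f _; set C := slice_comb f _.
(* Invertibility of [A^T B A] forces that of [A], so the congruence by [A] becomes a similarity on
   [B^-1 C]. *)
rewrite !unitmx_mul unitmx_tr => /andP[/andP[Au Bu] _] dA; split=> //.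
apply: (diagonalizable_conj Au); move: dA.
suff -> : invmx (A^T *m B *m A) *m (A^T *m C *m A) =
          invmx A *m (invmx B *m C) *m A by [].
have Tu : A^T *m B *m A \in unitmx by rewrite !unitmx_mul unitmx_tr Au Bu.
apply: (can_inj (mulKmx Tu)); rewrite mulKVmx // !mulmxA.
by rewrite mulmxK // mulmxK.
Qed.

(** Otherwise [B] itself would witness the Diagonalisability Property, since the slices span the
    space. *)
Lemma nondiagonalizable_slice f B : commutativity_property (slice_space f) ->
  ~ diagonalisability_property (slice_space f) ->
  B \in slice_space f -> B \in unitmx ->
  exists i, ~ diagonalizable (invmx B *m slice f i).
Proof.
move=> Vcomm Vndiag BV Bu; apply/not_existsP => dB; apply: Vndiag.
exists B; split=> //; apply: diagonalizable_mulmx_span => [M N MV NV|_ /mapP[i _ ->]].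
  by apply: (commutativity_property_all Vcomm BV Bu); apply: memv_span.
by apply: contrapT; apply: dB.
Qed.

Lemma slice_combB_eq f v w i : {in predC1 i, v =1 w} ->
  slice_comb f v - slice_comb f w = (v i - w i) *: slice f i.
Proof.
move=> vw; rewrite -sumrB (bigD1 i) //= big1 ?addr0 ?scalerBl // => k ki.
by rewrite vw // subrr.
Qed.

Lemma nondiagonalizable_coord_eq f B v w i :
  commutativity_property (slice_space f) ->
  B \in slice_space f -> B \in unitmx ->
  ~ diagonalizable (invmx B *m slice f i) ->
  {in predC1 i, v =1 w} ->
  diagonalizable (invmx B *m slice_comb f v) ->
  diagonalizable (invmx B *m slice_comb f w) -> v i = w i.
Proof.
move=> Vcomm BV Bu ndi vw dv dw; apply/eqP; rewrite -subr_eq0.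
apply: contraPT ndi => vwi; rewrite not_notE.
apply: (@diagonalizable_mulmx_span _ _ _ [:: slice_comb f v; slice_comb f w]).
- by move=> M N; rewrite !inE => /orP[]/eqP-> /orP[]/eqP->;
    apply: (commutativity_property_all Vcomm BV Bu); apply: mem_slice_comb.
- by move=> M; rewrite !inE => /orP[]/eqP->.
(* The slice is [(v i - w i)^-1] times the difference of the two combinations, hence in their
   span. *)
rewrite -[slice f i]scale1r -(mulVf vwi) -scalerA -slice_combB_eq //.
by apply/memvZ/memvB; apply: memv_span; rewrite !inE eqxx ?orbT.
Qed.

End SliceCombination.

(** * Counting matrices with one entry determined by the others *)

Definition agree_off (T : Type) (m n : nat) (p : 'I_m * 'I_n) (A B : 'M[T]_(m, n)) :=
  forall i j, (i, j) != p -> A i j = B i j.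

(** Overwriting the entry of [A] at [p A] by [t] is injective in [(A, t)] for [A] in [E]: the
    position survives the overwriting, the entry there gives [t], and the other entries determine
    [A]. *)
Lemma card_determined_entry (T : finType) (m n : nat) (E : pred 'M[T]_(m, n))
    (p : 'M[T]_(m, n) -> 'I_m * 'I_n) :
  (forall A B, agree_off (p A) A B -> p B = p A) ->
  (forall A B, E A -> E B -> agree_off (p A) A B -> A = B) ->
  (#|E| * #|T| <= #|T| ^ (m * n))%N.
Proof.
move=> p_inv E_inj.
pose put (A : 'M[T]_(m, n)) t := \matrix_(i, j) if (i, j) == p A then t else A i j.
have off A t : agree_off (p A) A (put A t) by move=> i j /negPf ne; rewrite mxE ne.
have at_ A t : put A t (p A).1 (p A).2 = t by rewrite mxE -surjective_pairing eqxx.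
have pput A t : p (put A t) = p A by apply/p_inv/off.
rewrite -(card_mx T m n) -cardX.
apply: (@leq_card_in _ _ (fun u => put u.1 u.2)) => -[A s] [B t] /=.
rewrite !inE /= => /andP[EA _] /andP[EB _] eq_put.
have eq_p : p A = p B by rewrite -(pput A s) eq_put pput.
rewrite -[s](at_ A) -[t](at_ B) eq_put eq_p; congr (_, _).
apply: E_inj => // i j ne; rewrite (off A s) // eq_put -(off B) //.
by rewrite -eq_p.
Qed.

Lemma prob_entries_determined_entry (R : realType) (K : choiceType) (n : nat)
    (S : {fset K}) (E : 'M[K]_n -> Prop) (p : 'M[S]_n -> 'I_n * 'I_n) :
  S != fset0 ->
  (forall A B, agree_off (p A) A B -> p B = p A) ->
  (forall A B, E (map_mx val A) -> E (map_mx val B) ->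
    agree_off (p A) A B -> A = B) ->
  prob_entries R S E <= 1 / #|` S|%:R.
Proof.
move=> S0 p_inv E_inj; rewrite /prob_entries.
have S_gt0 : (0 : R) < #|` S|%:R by rewrite ltr0n cardfs_gt0.
(* All matrices have the same mass, so the bound becomes a count. *)
under eq_bigr do rewrite !prodr_const !card_ord -exprM.
rewrite sumr_const -[leLHS]mulr_natl exprVn ler_pdivlMr //.
rewrite mulrAC ler_pdivrMr ?exprn_gt0 // mul1r -natrM -natrX ler_nat cardfE.
apply: card_determined_entry p_inv _ => A B /asboolP EA /asboolP EB.
exact: E_inj.
Qed.

Theorem theorem2p17 (R : realType) (kind : scalar_kind)
    (n : nat) (n_gt1 : (1 < n)%N)
    (f : {mpoly (scalars R kind)[n]}) (S : {fset scalars R kind})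
    (f_cubic : f \is 3.-homog)
    (S_nonempty : S != fset0)
    (V_nonsingular : nonsingular_space (slice_space f))
    (V_comm : commutativity_property (slice_space f))
    (V_not_diag : ~ diagonalisability_property (slice_space f)) :
  prob_entries R S (fun A : 'M[scalars R kind]_n =>
    let h := linear_subst f A in
    let T1 := slice h (Ordinal (ltnW n_gt1)) in
    let T2 := slice h (Ordinal n_gt1) in
    T1 \in unitmx /\ diagonalizable (invmx T1 *m T2))
  <= 1 / #|` S|%:R.
Proof.
set i0 := Ordinal (ltnW n_gt1); set i1 := Ordinal n_gt1.
pose D (A : 'M[S]_n) j := slice_comb f ((map_mx val A)^~ j).
pose bad A i := `[< ~ diagonalizable (invmx (D A i0) *m slice f i) >].
(* The row depends on column [i0] only, while the position lies in column [i1], so altering that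
   entry preserves [p]. The default row never occurs within the event, by [bad_p]. *)
pose p A := (odflt i0 [pick i | bad A i], i1).
have D0_eq A B : agree_off (p A) A B -> D A i0 = D B i0.
  move=> AB; apply: eq_bigr => k _; rewrite !mxE AB //.
  by rewrite xpair_eqE negb_and orbC.
apply: (@prob_entries_determined_entry _ _ _ _ _ p S_nonempty) => A B.
  by move=> /D0_eq eqD; rewrite /p /bad eqD.
move=> [uA dA] [uB dB] AB.
have [DAu dDA] := diagonalizable_linear_subst f_cubic uA dA.
have [_ dDB] := diagonalizable_linear_subst f_cubic uB dB.
have bad_p : bad A (p A).1.
  rewrite /p /=; case: pickP => //= bad0.
  have [i /asboolP] := nondiagonalizable_slice V_comm V_not_diag (mem_slice_comb f _) DAu.
  by rewrite -/(D A i0) -/(bad A i) bad0.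
have ABp : val (A (p A).1 i1) = val (B (p A).1 i1).
  have AB1 : {in predC1 (p A).1, (map_mx val A)^~ i1 =1 (map_mx val B)^~ i1}.
    by move=> k; rewrite inE => kp; rewrite !mxE AB // /p xpair_eqE negb_and kp.
  rewrite -/(D B i0) -(D0_eq _ _ AB) in dDB.
  have := nondiagonalizable_coord_eq V_comm (mem_slice_comb f _) DAu
    (asboolW bad_p) AB1 dDA dDB.
  by rewrite !mxE.
apply/matrixP => i j; have [ijp|/AB //] := eqVneq (i, j) (p A).
by apply: val_inj; move: ABp; rewrite -ijp /=; case: ijp => _ ->.
Qed.
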